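(* Let $n\geq 2$ be an integer. The multiplicative reduct of $\mathbf{M}'_n(S_7)$ is $5$-nilpotent, but is not $4$-nilpotent.
   Context: $S_7=\{1,a,\infty\}$ is the additively idempotent semiring with $x+x=x$ for all $x$ and $x+y=\infty$ for $x\neq y$; its multiplication is commutative with $1\cdot x=x$ for all $x$ and $a\cdot a=a\cdot\infty=\infty\cdot\infty=\infty$. $\mathbf{M}_n(S_7)$ is the semiring of all $n\times n$ matrices over $S_7$ with entrywise addition and product $(AB)_{ij}=\sum_{k=1}^n A_{ik}B_{kj}$. For $s\in S_7$, $[s]_n$ denotes the $n\times n$ matrix with all entries equal to $s$; $[\infty]_n$ is the multiplicative zero of $\mathbf{M}_n(S_7)$. $\mathbf{M}'_n(S_7)=\mathbf{M}_n(S_7)\setminus\{[1]_n\}$, which is a subsemiring of $\mathbf{M}_n(S_7)$. The multiplicative reduct of $\mathbf{M}'_n(S_7)$ is called $m$-nilpotent if the product of any $m$ matrices in $\mathbf{M}'_n(S_7)$ equals $[\infty]_n$. *)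

(* Defs.v *)
From HB Require Import structures.
From mathcomp Require Import all_boot all_order all_algebra.

Set Implicit Arguments.
Unset Strict Implicit.
Unset Printing Implicit Defensive.

Inductive S7 : Type := One7 | A7 | Inf7.

Definition S7_code (x : S7) : option bool :=
  match x with One7 => Some true | A7 => Some false | Inf7 => None end.

Definition S7_decode (c : option bool) : S7 :=
  match c with Some true => One7 | Some false => A7 | None => Inf7 end.

Lemma S7_codeK : cancel S7_code S7_decode.
Proof. by case. Qed.

HB.instance Definition _ := Finite.copy S7 (can_type S7_codeK).

Definition add7 (x y : S7) : S7 := if x == y then x else Inf7.

Definition mul7 (x y : S7) : S7 :=
  match x, y with
  | One7, z => z
  | z, One7 => z
  | _, _ => Inf7
  end.

Lemma add7A : associative add7. Proof. by do 3!case. Qed.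
Lemma add7C : commutative add7. Proof. by do 2!case. Qed.
Lemma add7xx : idempotent_op add7. Proof. by case. Qed.
Lemma mul7A : associative mul7. Proof. by do 3!case. Qed.
Lemma mul7C : commutative mul7. Proof. by do 2!case. Qed.
Lemma mul17 : left_id One7 mul7. Proof. by case. Qed.
Lemma mul7Dl : left_distributive mul7 add7.
Proof. by do 3!case. Qed.

(* [add7] has no neutral element, so only sums of nonempty sequences make
   sense; the value on [::] is junk, and [mulmx7] never uses it, since a 0 x 0
   matrix has no entry. *)
Definition sum7 (s : seq S7) : S7 :=
  if s is x :: s' then foldl add7 x s' else Inf7.

Definition addmx7 (n : nat) (A B : 'M[S7]_n) : 'M[S7]_n :=
  \matrix_(i, j) add7 (A i j) (B i j).

Definition mulmx7 (n : nat) (A B : 'M[S7]_n) : 'M[S7]_n :=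
  \matrix_(i, j) sum7 [seq mul7 (A i k) (B k j) | k <- enum 'I_n].

Definition Mprime (n : nat) : {set 'M[S7]_n} := [set~ const_mx One7].

Lemma sum7_one (s : seq S7) : sum7 s = One7 -> {in s, forall x, x = One7}.
Proof.
case: s => //= x s sE.
have H : forall s y, foldl add7 y s = One7 -> {in y :: s, forall x, x = One7}.
  elim=> [|z t IH] y /= => [-> u | /IH Ht u].
    by rewrite inE => /eqP.
  have [yE zE] : y = One7 /\ z = One7.
    by have := Ht _ (mem_head _ _); case: (y) (z) => [] [].
  rewrite !inE => /or3P[/eqP-> | /eqP-> | ut] //.
  by apply: Ht; rewrite inE ut orbT.
exact: H.
Qed.

Lemma Mprime_add (n : nat) (A B : 'M[S7]_n) :
  A \in Mprime n -> addmx7 A B \in Mprime n.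
Proof.
rewrite !in_setC1; apply: contra => /eqP/matrixP AB.
apply/eqP/matrixP => i j; move: (AB i j); rewrite !mxE.
by case: (A i j) (B i j) => [] [].
Qed.

Lemma Mprime_mul (n : nat) (A B : 'M[S7]_n) :
  A \in Mprime n -> mulmx7 A B \in Mprime n.
Proof.
rewrite !in_setC1; apply: contra => /eqP/matrixP AB.
apply/eqP/matrixP => i j; move: (AB i j); rewrite !mxE => /sum7_one.
move=> /(_ (mul7 (A i j) (B j j))) H.
have /H : mul7 (A i j) (B j j) \in [seq mul7 (A i k) (B k j) | k <- enum 'I_n].
  by apply/mapP; exists j; rewrite ?mem_enum.
by case: (A i j) (B j j) => [] [].
Qed.

(* [Mprime n] has no multiplicative identity, so the product of m >= 1 matrices
   is taken over a nonempty sequence A :: s of length m. *)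
Definition m_nilpotent (n m : nat) : Prop :=
  forall (A : 'M[S7]_n) (s : seq 'M[S7]_n),
    size (A :: s) = m ->
    {subset A :: s <= Mprime n} ->
    foldl (@mulmx7 n) A s = const_mx Inf7.

(* Main.v *)
(* An entry of a product other than infinity is 1 or a, and it equals all the
   path products it sums. In A B C D E it is not 1, as B is not constantly 1. If
   it is a, then every path carries exactly one factor a and no infinity; some
   entry (k, l) of B is an a, and every entry of D lies on a path through
   (k, l), so D is constantly 1, a contradiction. *)
Require Import Defs.
From mathcomp Require Import all_boot all_order all_algebra.

(** Two distinct summands give [Inf7], which absorbs every later one, so a finite value forces all
    summands to agree. *)
Lemma foldl_add7_eq (c x : S7) (s : seq S7) :
  c != Inf7 -> (foldl add7 x s == c) = all (pred1 c) (x :: s).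
Proof.
move=> cI; elim: s x => [|y s IH] x /=; first by rewrite andbT.
rewrite IH /= andbA; congr (_ && _).
by case: c x y cI {IH} => [] [] [].
Qed.

Lemma mulmx7P (n : nat) (A B : 'M[S7]_n) (i j : 'I_n) (c : S7) :
  c != Inf7 ->
  mulmx7 A B i j = c <-> forall k, mul7 (A i k) (B k j) = c.
Proof.
move=> cI; rewrite mxE.
have sumE : (sum7 [seq mul7 (A i k) (B k j) | k <- enum 'I_n] == c) =
            all (fun k => mul7 (A i k) (B k j) == c) (enum 'I_n).
  have : i \in enum 'I_n by rewrite mem_enum.
  case: (enum 'I_n) => // k s _.
  by rewrite /sum7 [map _ _]/= foldl_add7_eq //= all_map.
split=> [/eqP | H].
  by rewrite sumE => /allP H k; apply/eqP/H; rewrite mem_enum.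
by apply/eqP; rewrite sumE; apply/allP => k _; apply/eqP.
Qed.

(** Peels the last factor off a left-nested product, [y] being the path already read to its right.
    The entry [mulmx7 A B i k] cannot be [Inf7], since [Inf7] would absorb [y]; hence [mulmx7P]
    applies to it. *)
Lemma mulmx7_path (n : nat) (A B : 'M[S7]_n) (i k : 'I_n) (y c : S7) :
  c != Inf7 -> mul7 (mulmx7 A B i k) y = c ->
  forall l, mul7 (A i l) (mul7 (B l k) y) = c.
Proof.
move=> cI; case E: (mulmx7 A B i k) => Ec l; last by case: y c cI Ec => [] [].
all: by move/mulmx7P: E => /(_ isT l) E; rewrite mul7A E.
Qed.

Lemma MprimeP (n : nat) (A : 'M[S7]_n) :
  reflect (exists i j, A i j <> One7) (A \in Mprime n).
Proof.
rewrite in_setC1; apply: (iffP idP) => [A1 | [i [j Aij]]]; last first.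
  by apply/eqP => AE; apply: Aij; rewrite AE mxE.
have /existsP[i /existsP[j /eqP Aij]] : [exists i, exists j, A i j != One7].
  apply: contraR A1 => /existsPn H; apply/eqP/matrixP => i j.
  by have /existsPn/(_ j)/negPn/eqP -> := H i; rewrite mxE.
by exists i, j.
Qed.

Lemma m_nilpotent5 (n : nat) : m_nilpotent n 5.
Proof.
move=> A [|B [|C [|D [|E []]]]] //= _ sub.
have /MprimeP[k [l Bkl]] : B \in Mprime n by apply: sub; rewrite !inE eqxx orbT.
have /MprimeP[m [p Dmp]] : D \in Mprime n by apply: sub; rewrite !inE eqxx !orbT.
apply/matrixP => i j; rewrite [RHS]mxE.
case: (eqVneq (mulmx7 (mulmx7 (mulmx7 (mulmx7 A B) C) D) E i j) Inf7) => // cI.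
(* The entries [B k l] and [D m p] share no index, so the single path [i, k, l, m, p, j] runs
   through both, with [C l m] as the bridge. It is read off from right to left. *)
have /(mulmx7P _ _ _ _ _ _ cI)/(_ p) :=
  erefl (mulmx7 (mulmx7 (mulmx7 (mulmx7 A B) C) D) E i j).
move=> /(mulmx7_path _ _ _ _ _ _ _ cI)/(_ m).
move=> /(mulmx7_path _ _ _ _ _ _ _ cI)/(_ l).
move=> /(mulmx7_path _ _ _ _ _ _ _ cI)/(_ k) pathE.
move: cI; rewrite -{}pathE.
(* Two factors other than [One7] already multiply to [Inf7]. *)
by case: (A i k) (B k l) (C l m) (D m p) (E p j) Bkl Dmp => [] [] [] [] [].
Qed.

Lemma not_m_nilpotent4 (n : nat) : 2 <= n -> ~ m_nilpotent n 4.
Proof.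
case: n => [|[|n]] // _ nil4.
(* In [A B C B], every path from [ord0] to [ord0] meets exactly one [A7]: at the middle index [l],
   the first [B] supplies it if [l] is not [ord0], and [C] if it is. Row [ord0] of [A] and column
   [ord0] of the last [B] contain only [One7]. *)
pose A : 'M[S7]_n.+2 :=
    (\matrix_(i, j) if i == ord0 then One7 else A7)%R.
pose B : 'M[S7]_n.+2 :=
    (\matrix_(i, j) if j == ord0 then One7 else A7)%R.
pose C : 'M[S7]_n.+2 :=
    (\matrix_(i, j) if i == ord0 then A7 else One7)%R.
have subM : {subset [:: A; B; C; B] <= Mprime n.+2}.
  move=> X; rewrite !inE => /or4P[] /eqP->; rewrite -in_setC1; apply/MprimeP.
  - by exists ord_max, ord0; rewrite mxE.
  - by exists ord0, ord_max; rewrite mxE.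
  - by exists ord0, ord0; rewrite mxE.
  - by exists ord0, ord_max; rewrite mxE.
have AB l : mulmx7 A B ord0 l = if l == ord0 then One7 else A7.
  by apply/mulmx7P => [|k]; rewrite ?mxE; case: (l == ord0).
have ABC m : mulmx7 (mulmx7 A B) C ord0 m = A7.
  by apply/mulmx7P => // l; rewrite AB mxE; case: (l == ord0).
have ABCB : mulmx7 (mulmx7 (mulmx7 A B) C) B ord0 ord0 = A7.
  by apply/mulmx7P => // m; rewrite ABC mxE.
have /= /matrixP/(_ ord0 ord0) := nil4 A [:: B; C; B] erefl subM.
by rewrite ABCB mxE.
Qed.

Theorem proposition5p8 (n : nat) (hn : 2 <= n) :
  m_nilpotent n 5 /\ ~ m_nilpotent n 4.
Proof. by split; [exact: m_nilpotent5 | exact: not_m_nilpotent4]. Qed.
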